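(* Let $T$ be an automorphism of a measurable space $(X,\mathcal F)$ and let $\mu_0$ be a $T$-invariant probability measure on $(X,\mathcal F)$. Let $\xi$ be a countable (finite or countably infinite) measurable partition of $(X,\mathcal F)$ with finite entropy $H_{\mu_0}(\xi)<\infty$. Assume that there exist $T$-invariant probability measures $\mu_n$, $n\ge 1$, numbers $r_n\in\mathbb N$, $\varepsilon_n>0$ ($n\ge 0$), and a number $h$ such that $$\lim_{n\to\infty} r_n=\infty,\qquad \lim_{n\to\infty}\varepsilon_n=0,\qquad \limsup_{n\to\infty} h_{\mu_n}(T)\ge h\ge 0,$$ $\xi$ is a generator for $(T,\mu_n)$ for every $n\ge 0$, and $$|\mu_0(A)-\mu_n(A)|\le \varepsilon_n\,\mu_n(A)\quad\text{for every atom } A \text{ of the partition } \bigvee_{i=0}^{r_n}T^{-i}\xi \text{ and every } n\ge 0.$$ Then $h_{\mu_0}(T)\ge h$.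
   Context: $h_\mu(T)$ denotes the Kolmogorov–Sinai entropy of $T$ with respect to a $T$-invariant probability measure $\mu$, and $H_\mu(\eta)=-\sum_{B\in\eta}\mu(B)\ln\mu(B)$ is the entropy of a countable partition $\eta$. A partition $\xi$ is a generator for $(T,\mu)$ if the $\sigma$-algebra generated by the partitions $T^{i}\xi$, $i\in\mathbb Z$, coincides with $\mathcal F$ modulo $\mu$-null sets. $\bigvee_{i=0}^{r}T^{-i}\xi$ is the common refinement of the partitions $\xi, T^{-1}\xi,\dots,T^{-r}\xi$. *)

(* Defs.v *)
From HB Require Import structures.
From mathcomp Require Import all_boot all_order all_algebra.
From mathcomp Require Import all_classical all_reals all_analysis.
Set Implicit Arguments. Unset Strict Implicit. Unset Printing Implicit Defensive.
Import Order.TTheory GRing.Theory Num.Theory.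
Local Open Scope classical_set_scope.
Local Open Scope ring_scope.

Section Defs.
Context {d : measure_display} {X : measurableType d} {R : realType}.

Definition is_partition (P : set (set X)) : Prop :=
  [/\ countable P,
      (forall A, P A -> measurable A),
      (forall A B, P A -> P B -> A <> B -> A `&` B = set0)
    & \bigcup_(A in P) A = setT].

Definition join_part (P Q : set (set X)) : set (set X) :=
  [set A `&` B | A in P & B in Q].

Definition preim_part (f : X -> X) (P : set (set X)) : set (set X) :=
  [set f @^-1` A | A in P].

Fixpoint iter_join (T : X -> X) (P : set (set X)) (r : nat) : set (set X) :=
  match r with
  | 0 => P
  | r'.+1 => join_part (iter_join T P r') (preim_part (iter r'.+1 T) P)
  end.

(* eta(p) = - p ln p  (with ln 0 = 0, so eta 0 = 0) *)
Definition eta_fn (p : R) : R := - (p * ln p).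

Definition part_entropy (mu : probability X R) (P : set (set X)) : \bar R :=
  (\esum_(A in P) (eta_fn (fine (mu A)))%:E)%E.

Definition part_ks_entropy (mu : probability X R) (T : X -> X)
    (P : set (set X)) : \bar R :=
  limn (fun n : nat => ((n.+1%:R)^-1)%:E * part_entropy mu (iter_join T P n))%E.

Definition ks_entropy (mu : probability X R) (T : X -> X) : \bar R :=
  ereal_sup [set part_ks_entropy mu T P |
             P in [set P | is_partition P /\ finite_set P]].

Definition T_invariant (mu : probability X R) (T : X -> X) : Prop :=
  forall A, measurable A -> mu (T @^-1` A) = mu A.

(* P is a generator for (T, mu), where S is the inverse of T: the
   sigma-algebra generated by all T^i P (i in Z) -- i.e. by the
   S^{-k} P = T^k P and T^{-k} P, k in N -- coincides with F mod mu-null sets *)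
Definition is_generator (mu : probability X R) (T S : X -> X)
    (P : set (set X)) : Prop :=
  forall A, measurable A ->
    exists B, <<s \bigcup_(k in [set: nat])
                    (preim_part (iter k S) P `|` preim_part (iter k T) P) >> B
              /\ mu ((A `\` B) `|` (B `\` A)) = 0%E.

End Defs.

(* Main.v *)
(* Entropies of countable partitions are avoided: [xi] is coded by a function
   [a : X -> nat] and approximated by the finite-valued truncations
   [min (a, k)], so that all entropies are finite real sums.
   For each [mu n], the generator hypothesis and the conditional entropy
   calculus bound the entropy rate of every finite partition by the block
   entropy rate [H_n(q_k^r) / r] of some truncation [q_k], for every block
   length [r].  At the length [r n + 1] the ratio bound on atoms passes to the
   atoms of [q_k^r], since these are unions of atoms of the full partition, and
   replaces [H_n] by [H_0] up to a factor [1 / (1 - eps)] and an error [eps].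
   Finally [H_0(q_k)] increases to the finite entropy of [xi], so one fixed
   truncation [q_m] controls all [H_0(q_k^r) / r] uniformly in [k] and [r], and
   its rate converges to at most the entropy of [T] for [mu 0]. *)
Require Import Defs.
From HB Require Import structures.
From mathcomp Require Import all_boot all_order all_algebra.
From mathcomp Require Import all_classical all_reals all_analysis.
From mathcomp Require Import ring lra zify.
Set Implicit Arguments. Unset Strict Implicit. Unset Printing Implicit Defensive.
Import Order.TTheory GRing.Theory Num.Theory.
Import numFieldNormedType.Exports.
Local Open Scope classical_set_scope.
Local Open Scope ring_scope.

(** * Conditional entropy of finite-valued functions *)

Section DiscreteEntropy.
Context {R : realType}.
Implicit Types p q a b x y : R.

Lemma eta0 : eta_fn 0 = 0 :> R.
Proof. by rewrite /eta_fn mul0r oppr0. Qed.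

Lemma eta1 : eta_fn 1 = 0 :> R.
Proof. by rewrite /eta_fn ln1 mulr0 oppr0. Qed.

Lemma eta_ge0 p : 0 <= p <= 1 -> 0 <= eta_fn p.
Proof.
by move=> /andP[p0 p1]; rewrite /eta_fn oppr_ge0 mulr_ge0_le0// ln_le0.
Qed.

Lemma ln_le_subr1 x : 0 < x -> ln x <= x - 1.
Proof.
move=> x0; have := @le_ln1Dx R (x - 1); rewrite (_ : 1 + (x - 1) = x); last by ring.
by apply; lra.
Qed.

Lemma eta_le_sub p : 0 <= p -> eta_fn p <= 1 - p.
Proof.
rewrite le_eqVlt => /predU1P[<-|p0]; first by rewrite eta0 subr0.
have := @ln_le_subr1 p^-1; rewrite invr_gt0 lnV ?posrE// => /(_ p0) H.
rewrite /eta_fn -mulrN; apply: le_trans (_ : p * (p^-1 - 1) <= _).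
  by rewrite ler_pM2l.
by rewrite mulrBr mulfV ?gt_eqF// mulr1.
Qed.

(** For [p = s ^+ 2], [eta_fn p] equals [2 * s * eta_fn s], and [eta_fn s <= 1 - s <= 1]. *)
Lemma eta_le_sqrt p : 0 <= p -> eta_fn p <= 2 * Num.sqrt p.
Proof.
rewrite le_eqVlt => /predU1P[<-|p0]; first by rewrite eta0 sqrtr0 mulr0.
set s := Num.sqrt p; have s0 : 0 < s by rewrite sqrtr_gt0.
have ps : p = s ^+ 2 by rewrite sqr_sqrtr// ltW.
have := eta_le_sub (ltW s0); rewrite /eta_fn ps lnXn// => H.
have -> : - (s ^+ 2 * (ln s *+ 2)) = (2 * s) * - (s * ln s) by ring.
rewrite -[leRHS]mulr1 ler_pM2l; last by lra.
lra.
Qed.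

Lemma eta_sum_le (I : finType) (p : I -> R) : (forall i, 0 <= p i) ->
  eta_fn (\sum_i p i) <= \sum_i eta_fn (p i).
Proof.
move=> p0; rewrite /eta_fn mulr_suml -sumrN; apply: ler_sum => i _.
have := p0 i; rewrite le_eqVlt => /predU1P[<-|pi0]; first by rewrite !mul0r.
have le_pS : p i <= \sum_j p j by rewrite (bigD1 i)//= lerDl sumr_ge0.
rewrite lerN2 ler_pM2l// ler_ln ?posrE//; exact: lt_le_trans le_pS.
Qed.

(* [ln x <= x - 1] at [x = a b / (p q)]; the product [a b / q] is a
   probability vector again, so the last two terms cancel after summation. *)
Lemma eta_ssa_pointwise p q a b : 0 <= p -> p <= a -> p <= b -> p <= q ->
  - (p * ln p) + - (p * ln q) <= - (p * ln a) + - (p * ln b) + (a * b / q - p).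
Proof.
rewrite le_eqVlt => /predU1P[<-|p0] pa pb pq.
  by rewrite !mul0r oppr0 !addr0 add0r !mulr_ge0 ?invr_ge0.
have [a0 b0 q0] : [/\ 0 < a, 0 < b & 0 < q] by split; exact: lt_le_trans p0 _.
have pn0 : p != 0 by rewrite gt_eqF.
have qn0 : q != 0 by rewrite gt_eqF.
have [ab0 pq0] : 0 < a * b /\ 0 < p * q by split; exact: mulr_gt0.
have := ln_le_subr1 (divr_gt0 ab0 pq0).
rewrite ln_div ?posrE// (lnM a0 b0) (lnM p0 q0) -(ler_pM2l p0).
have -> : p * (a * b / (p * q) - 1) = a * b / q - p by field; rewrite pn0 qn0.
set la := ln a; set lb := ln b; set lp := ln p; set lq := ln q.
move: (a * b / q - p) => z; rewrite mulrBr !mulrDr; lra.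
Qed.

(** Strong subadditivity of Shannon entropy, the source of the conditional entropy calculus below.
    Each entropy is spread over all triples, so that [eta_ssa_pointwise] applies term by term. *)
Lemma eta_ssa (I J K : finType) (p : I -> J -> K -> R) :
  (forall i j k, 0 <= p i j k) ->
  \sum_i \sum_j \sum_k eta_fn (p i j k) + \sum_j eta_fn (\sum_i \sum_k p i j k)
  <= \sum_i \sum_j eta_fn (\sum_k p i j k)
   + \sum_j \sum_k eta_fn (\sum_i p i j k).
Proof.
move=> p0.
pose a i j := \sum_k p i j k; pose b j k := \sum_i p i j k.
pose q j := \sum_i a i j.
have qb j : q j = \sum_k b j k by rewrite /q /a exchange_big.
have a0 i j : 0 <= a i j by exact: sumr_ge0.
have b0 j k : 0 <= b j k by exact: sumr_ge0.
have q0 j : 0 <= q j by exact: sumr_ge0.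
have pa i j k : p i j k <= a i j by rewrite /a (bigD1 k)//= lerDl sumr_ge0.
have pb i j k : p i j k <= b j k by rewrite /b (bigD1 i)//= lerDl sumr_ge0.
have aq i j : a i j <= q j by rewrite /q (bigD1 i)//= lerDl sumr_ge0.
have E1 : \sum_j eta_fn (q j) = \sum_i \sum_j \sum_k - (p i j k * ln (q j)).
  rewrite exchange_big; apply: eq_bigr => j _; rewrite /eta_fn {1}/q mulr_suml.
  rewrite -sumrN; apply: eq_bigr => i _; rewrite /a mulr_suml -sumrN//.
have E2 : \sum_i \sum_j eta_fn (a i j)
    = \sum_i \sum_j \sum_k - (p i j k * ln (a i j)).
  apply: eq_bigr => i _; apply: eq_bigr => j _.
  by rewrite /eta_fn {1}/a mulr_suml -sumrN.
have E3 : \sum_j \sum_k eta_fn (b j k)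
    = \sum_i \sum_j \sum_k - (p i j k * ln (b j k)).
  rewrite [RHS]exchange_big; apply: eq_bigr => j _; rewrite [RHS]exchange_big.
  by apply: eq_bigr => k _; rewrite /eta_fn {1}/b mulr_suml -sumrN.
have E4 : \sum_i \sum_j \sum_k (a i j * b j k / q j - p i j k) = 0.
  rewrite exchange_big big1// => j _.
  rewrite (eq_bigr (fun i => \sum_k a i j * b j k / q j - a i j)); last first.
    by move=> i _; rewrite sumrB.
  rewrite sumrB -/(q j).
  have Ek i : \sum_k a i j * b j k / q j = a i j * q j / q j.
    by rewrite qb mulr_sumr mulr_suml.
  under [X in X - _]eq_bigr do rewrite Ek.
  rewrite -mulr_suml -mulr_suml -/(q j).
  have [->|qn0] := eqVneq (q j) 0; first by rewrite !mul0r subrr.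
  by rewrite mulfK// subrr.
rewrite E1 E2 E3 -[leRHS]addr0 -[X in _ <= _ + X]E4 -!big_split/=.
apply: ler_sum => i _; rewrite -!big_split/=.
apply: ler_sum => j _; rewrite -!big_split/=.
apply: ler_sum => k _; exact: eta_ssa_pointwise (le_trans (pa i j k) (aq i j)).
Qed.

End DiscreteEntropy.

(** * Entropy of finite-valued measurable functions *)

Section FiniteEntropy.
Context {d : measure_display} {X : measurableType d} {R : realType}.
Implicit Types (mu : probability X R) (A B : set X).

(** Partitions are represented by functions, with the nonempty fibres as atoms. No sigma-algebra on
    the codomain is needed. *)
Definition measurable_fibers (I : Type) (f : X -> I) : Prop :=
  forall i, measurable (f @^-1` [set i]).

(** The partition of [g] refines that of [f]. *)
Definition determines (I J : Type) (g : X -> J) (f : X -> I) : Prop :=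
  forall x y, g x = g y -> f x = f y.

Definition pairf (I J : Type) (f : X -> I) (g : X -> J) (x : X) : I * J :=
  (f x, g x).

Definition fentropy mu (I : finType) (f : X -> I) : R :=
  \sum_i eta_fn (fine (mu (f @^-1` [set i]))).

(** The chain rule serves as the definition, so no conditional measures occur. *)
Definition cond_fentropy mu (I J : finType) (f : X -> I) (g : X -> J) : R :=
  fentropy mu (pairf f g) - fentropy mu g.

Lemma preimage_pairf (I J : Type) (f : X -> I) (g : X -> J) i j :
  pairf f g @^-1` [set (i, j)] = f @^-1` [set i] `&` g @^-1` [set j].
Proof. by apply/seteqP; split => x /=; rewrite /pairf => -[-> ->]. Qed.

(** Such a set is the union of the countably many fibres of [g] that it meets. *)
Lemma measurable_saturated (J : countType) (g : X -> J) A :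
  measurable_fibers g -> (forall x y, g x = g y -> A x -> A y) -> measurable A.
Proof.
move=> mg sA.
pose F j := if pselect (exists2 x, A x & g x = j) then g @^-1` [set j] else set0.
have -> : A = \bigcup_j F j.
  apply/seteqP; split => [x Ax|x [j _]]; rewrite /F.
    exists (g x) => //; case: pselect => // -[]; by exists x.
  by case: pselect => // -[y Ay gy] /= gx; apply: sA Ay; rewrite gx.
apply: countable_bigcupT_measurable; first exact: countableP.
by move=> j; rewrite /F; case: pselect => [h|h]; [exact: mg|exact: measurable0].
Qed.

Lemma measurable_fibers_determined (I : Type) (J : countType) (f : X -> I)
  (g : X -> J) : measurable_fibers g -> determines g f -> measurable_fibers f.
Proof.
by move=> mg gf i; apply: (measurable_saturated mg) => x y /gf /= ->.
Qed.

Lemma measurable_fibers_pairf (I J : Type) (f : X -> I) (g : X -> J) :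
  measurable_fibers f -> measurable_fibers g -> measurable_fibers (pairf f g).
Proof. by move=> mf mg [i j]; rewrite preimage_pairf; exact: measurableI. Qed.

Lemma fine_mu_itv mu A : measurable A -> 0 <= fine (mu A) <= 1.
Proof.
move=> mA; rewrite fine_ge0//= -lee_fin fineK ?probability_le1//.
exact: fin_num_measure.
Qed.

Lemma fine_mu_le mu A B : measurable A -> measurable B -> A `<=` B ->
  fine (mu A) <= fine (mu B).
Proof.
move=> mA mB AB; by apply: fine_le; rewrite ?fin_num_measure//; apply: le_measure; rewrite ?inE.
Qed.

Lemma fine_mu_fibers mu (J : finType) (g : X -> J) A :
  measurable_fibers g -> measurable A ->
  fine (mu A) = \sum_j fine (mu (A `&` g @^-1` [set j])).
Proof.
move=> mg mA.
have mAg j : measurable (A `&` g @^-1` [set j]) by exact: measurableI.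
have fin j : mu (A `&` g @^-1` [set j]) \is a fin_num by exact: fin_num_measure.
rewrite sum_fine//; congr fine.
rewrite (fsbig_seq _ _ (index_enum_uniq J)) -measure_fin_bigcup//.
- congr (mu _); apply/seteqP; split => [x Ax|x [j _ []//]].
  by exists (g x) => //=; rewrite mem_index_enum.
- by move=> i j _ _ [x [[_ /= <-] [_ /= <-]]].
Qed.

Lemma fine_muC mu A : measurable A -> fine (mu (~` A)) = 1 - fine (mu A).
Proof.
move=> mA; rewrite probability_setC// fineB//; exact: fin_num_measure.
Qed.

Lemma fentropy_pairfE mu (I J : finType) (f : X -> I) (g : X -> J) :
  fentropy mu (pairf f g) =
  \sum_i \sum_j eta_fn (fine (mu (f @^-1` [set i] `&` g @^-1` [set j]))).
Proof.
rewrite pair_bigA; apply: eq_bigr => -[i j] _ /=; by rewrite preimage_pairf.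
Qed.

Lemma fentropy_ge0 mu (I : finType) (f : X -> I) : measurable_fibers f ->
  0 <= fentropy mu f.
Proof. by move=> mf; apply: sumr_ge0 => i _; rewrite eta_ge0 ?fine_mu_itv. Qed.

Lemma fentropy_cst mu (I : finType) (f : X -> I) : (forall x y, f x = f y) ->
  fentropy mu f = 0.
Proof.
move=> fc; apply: big1 => i _.
have [[x fx]|nx] := pselect (exists x, f x = i).
  rewrite (_ : _ @^-1` _ = setT) ?probability_setT ?eta1//.
  by apply/seteqP; split => // y _ /=; rewrite -fx; exact: fc.
rewrite (_ : _ @^-1` _ = set0) ?measure0 ?eta0//.
by rewrite -subset0 => x /= fx; apply: nx; exists x.
Qed.

Lemma fentropy_ssa mu (I J K : finType) (f : X -> I) (g : X -> J) (k : X -> K) :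
  measurable_fibers f -> measurable_fibers g -> measurable_fibers k ->
  fentropy mu (pairf f (pairf g k)) + fentropy mu g <=
  fentropy mu (pairf f g) + fentropy mu (pairf g k).
Proof.
move=> mf mg mk.
pose p i j l := fine (mu (f @^-1` [set i] `&` (g @^-1` [set j] `&` k @^-1` [set l]))).
have p0 i j l : 0 <= p i j l.
  by case/andP: (fine_mu_itv mu (measurableI _ _ (mf i) (measurableI _ _ (mg j) (mk l)))).
have Efg i j : fine (mu (f @^-1` [set i] `&` g @^-1` [set j])) = \sum_l p i j l.
  rewrite (fine_mu_fibers mu mk (measurableI _ _ (mf i) (mg j))).
  by apply: eq_bigr => l _; rewrite /p setIA.
have Egk j l : fine (mu (g @^-1` [set j] `&` k @^-1` [set l])) = \sum_i p i j l.
  rewrite (fine_mu_fibers mu mf (measurableI _ _ (mg j) (mk l))).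
  by apply: eq_bigr => i _; rewrite setIC.
have Eg j : fine (mu (g @^-1` [set j])) = \sum_i \sum_l p i j l.
  rewrite (fine_mu_fibers mu mf (mg j)).
  by apply: eq_bigr => i _; rewrite setIC Efg.
have := eta_ssa p0.
rewrite !fentropy_pairfE /fentropy.
under [X in _ -> X + _ <= _]eq_bigr => i _.
  rewrite (_ : \sum_j _ = \sum_j \sum_l eta_fn (p i j l)); last first.
    rewrite pair_bigA/=; apply: eq_bigr => -[j l] _ /=; by rewrite preimage_pairf.
  over.
under [X in _ -> _ + X <= _]eq_bigr do rewrite Eg.
under [X in _ -> _ <= X + _]eq_bigr do under eq_bigr do rewrite Efg.
by under [X in _ -> _ <= _ + X]eq_bigr do under eq_bigr do rewrite Egk.
Qed.

(** A nonempty fibre of [g] meets exactly one fibre of [f]; the empty intersections contribute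
    [eta_fn 0 = 0]. *)
Lemma fentropy_determined_pair mu (I J : finType) (f : X -> I) (g : X -> J) :
  determines g f -> fentropy mu (pairf f g) = fentropy mu g.
Proof.
move=> gf; rewrite fentropy_pairfE exchange_big; apply: eq_bigr => j _ /=.
have [[x gx]|nx] := pselect (exists x, g x = j); last first.
  have g0 : g @^-1` [set j] = set0.
    by rewrite -subset0 => x /= gx; apply: nx; exists x.
  by rewrite g0 big1 => [|i _]; rewrite ?setI0 measure0 eta0.
rewrite (bigD1 (f x))//= big1 ?addr0 => [|i ifx].
  congr (eta_fn (fine (mu _))); apply/seteqP; split => [y []//|y /= gy].
  by split=> //=; apply: gf; rewrite gx.
rewrite (_ : _ `&` _ = set0) ?measure0 ?eta0// -subset0 => y /= [fy gy].
by move/eqP: ifx; apply; rewrite -fy; apply: gf; rewrite gx.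
Qed.

Lemma fentropy_le_pairr mu (I J : finType) (f : X -> I) (g : X -> J) :
  measurable_fibers f -> measurable_fibers g ->
  fentropy mu f <= fentropy mu (pairf f g).
Proof.
move=> mf mg; rewrite fentropy_pairfE; apply: ler_sum => i _.
rewrite (fine_mu_fibers mu mg)//; apply: eta_sum_le => j.
by case/andP: (fine_mu_itv mu (measurableI _ _ (mf i) (mg j))).
Qed.

Lemma fentropy_le mu (I J : finType) (f : X -> I) (g : X -> J) :
  measurable_fibers g -> determines g f -> fentropy mu f <= fentropy mu g.
Proof.
move=> mg gf; rewrite -(fentropy_determined_pair mu gf).
by apply: fentropy_le_pairr => //; exact: measurable_fibers_determined gf.
Qed.

Lemma fentropy_eq mu (I J : finType) (f : X -> I) (g : X -> J) :
  measurable_fibers g -> determines g f -> determines f g ->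
  fentropy mu f = fentropy mu g.
Proof.
move=> mg gf fg; apply/eqP; rewrite eq_le !fentropy_le//.
exact: measurable_fibers_determined gf.
Qed.

Lemma fentropy_pair_le mu (I J : finType) (f : X -> I) (g : X -> J) :
  measurable_fibers f -> measurable_fibers g ->
  fentropy mu (pairf f g) <= fentropy mu f + fentropy mu g.
Proof.
(* Strong subadditivity over the trivial partition [u], whose entropy is zero. *)
move=> mf mg; pose u (x : X) := tt.
have mu_ : measurable_fibers u.
  by move=> -[]; rewrite (_ : _ @^-1` _ = setT)//; apply/seteqP; split.
have := fentropy_ssa mu mf mu_ mg; rewrite (@fentropy_cst mu _ u)// addr0.
rewrite (_ : fentropy mu (pairf f (pairf u g)) = fentropy mu (pairf f g)); last first.
  apply: fentropy_eq; first exact: measurable_fibers_pairf.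
    by move=> x y; rewrite /pairf => -[-> ->].
  by move=> x y [] fxy gxy; rewrite /pairf fxy gxy.
rewrite (_ : fentropy mu (pairf f u) = fentropy mu f); last first.
  by apply: fentropy_eq => // x y; rewrite /pairf; [move=> ->|case].
by rewrite (_ : fentropy mu (pairf u g) = fentropy mu g)// fentropy_determined_pair.
Qed.

(** Strong subadditivity with the coarser [k] in the middle; [g] absorbs [k] in every pair. *)
Lemma cond_fentropy_le_of_determines mu (I J K : finType) (f : X -> I)
  (g : X -> J) (k : X -> K) :
  measurable_fibers f -> measurable_fibers g -> determines g k ->
  cond_fentropy mu f g <= cond_fentropy mu f k.
Proof.
move=> mf mg gk; have mk := measurable_fibers_determined mg gk.
have := fentropy_ssa mu mf mk mg.
rewrite (fentropy_determined_pair mu gk) /cond_fentropy.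
rewrite (@fentropy_eq mu _ _ (pairf f (pairf k g)) (pairf f g)).
- by rewrite -lerBrDr => H; lra.
- exact: measurable_fibers_pairf.
- by move=> x y [fxy gxy]; rewrite /pairf fxy gxy (gk _ _ gxy).
- by move=> x y [fxy kxy gxy]; rewrite /pairf fxy gxy.
Qed.

Lemma cond_fentropy_eq mu (I I' J J' : finType) (f : X -> I) (f' : X -> I')
  (g : X -> J) (g' : X -> J') :
  measurable_fibers f -> measurable_fibers g ->
  determines g g' -> determines g' g -> determines f f' -> determines f' f ->
  cond_fentropy mu f' g' = cond_fentropy mu f g.
Proof.
move=> mf mg gg' g'g ff' f'f; rewrite /cond_fentropy (fentropy_eq mu mg gg' g'g).
congr (_ - _); apply: fentropy_eq; first exact: measurable_fibers_pairf.
- by move=> x y [/ff' fxy /gg' gxy]; rewrite /pairf fxy gxy.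
- by move=> x y [/f'f fxy /g'g gxy]; rewrite /pairf fxy gxy.
Qed.

Lemma cond_fentropy_pair_le mu (I I' J : finType) (f : X -> I) (f' : X -> I')
  (g : X -> J) :
  measurable_fibers f -> measurable_fibers f' -> measurable_fibers g ->
  cond_fentropy mu (pairf f f') g <= cond_fentropy mu f g + cond_fentropy mu f' g.
Proof.
move=> mf mf' mg; have := fentropy_ssa mu mf mg mf'; rewrite /cond_fentropy.
rewrite (@fentropy_eq mu _ _ (pairf g f') (pairf f' g)).
- rewrite (@fentropy_eq mu _ _ (pairf f (pairf g f')) (pairf (pairf f f') g)).
  + by move=> H; lra.
  + by do 2![apply: measurable_fibers_pairf => //].
  + by move=> x y; rewrite /pairf => -[-> -> ->].
  + by move=> x y; rewrite /pairf => -[-> -> ->].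
- exact: measurable_fibers_pairf.
- by move=> x y; rewrite /pairf => -[-> ->].
- by move=> x y; rewrite /pairf => -[-> ->].
Qed.

Lemma fentropy_le_cond mu (I J : finType) (f : X -> I) (g : X -> J) :
  measurable_fibers f -> measurable_fibers g ->
  fentropy mu f <= fentropy mu g + cond_fentropy mu f g.
Proof. by move=> mf mg; rewrite /cond_fentropy addrC subrK fentropy_le_pairr. Qed.

End FiniteEntropy.

(** * Block entropies *)

Section BlockEntropy.
Context {d : measure_display} {X : measurableType d} {R : realType}.
Context (mu : probability X R) (T : X -> X).
Hypotheses (mT : measurable_fun setT T) (invT : T_invariant mu T).

(** The [n]-name of [x], reading times [0] to [n - 1]; the join up to [T^{-n}] therefore corresponds
    to length [n.+1]. *)
Definition block (I : Type) (f : X -> I) (n : nat) (x : X) : {ffun 'I_n -> I} :=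
  [ffun i : 'I_n => f (iter i T x)].

Lemma eq_blockP (I : Type) (f : X -> I) n x y : block f n x = block f n y <->
  forall i, (i < n)%N -> f (iter i T x) = f (iter i T y).
Proof.
split => [/ffunP e i ilt|e]; first by have := e (Ordinal ilt); rewrite !ffunE.
by apply/ffunP => i; rewrite !ffunE; exact: e.
Qed.

Lemma measurable_iter_preimage n A : measurable A -> measurable (iter n T @^-1` A).
Proof.
elim: n => [//|n IH] in A * => mA.
have -> : iter n.+1 T @^-1` A = iter n T @^-1` (T @^-1` A) by [].
by apply: IH; rewrite -[X in measurable X]setTI; exact: mT.
Qed.

Lemma mu_iter_preimage n A : measurable A -> mu (iter n T @^-1` A) = mu A.
Proof.
elim: n => [//|n IH] in A * => mA.
have -> : iter n.+1 T @^-1` A = iter n T @^-1` (T @^-1` A) by [].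
by rewrite IH ?invT// -[X in measurable X]setTI; exact: mT.
Qed.

Lemma measurable_fibers_iter (I : Type) (f : X -> I) n :
  measurable_fibers f -> measurable_fibers (f \o iter n T).
Proof.
move=> mf i; rewrite comp_preimage; apply: measurable_iter_preimage; exact: mf.
Qed.

Lemma measurable_fibers_block (I : Type) (f : X -> I) n :
  measurable_fibers f -> measurable_fibers (block f n).
Proof.
move=> mf u.
have -> : block f n @^-1` [set u] =
    ~` \bigcup_(i in [set: 'I_n]) ~` ((f \o iter i T) @^-1` [set u i]).
  rewrite setC_bigcup; apply/seteqP; split => x /=.
    by move=> <- i _ /=; rewrite ffunE; apply.
  by move=> h; apply/ffunP => i; rewrite ffunE; exact: (contrapT (h i Logic.I)).
apply: measurableC; apply: fin_bigcup_measurable => // i _.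
exact/measurableC/measurable_fibers_iter.
Qed.

Lemma fentropy_iter (I : finType) (f : X -> I) n : measurable_fibers f ->
  fentropy mu (f \o iter n T) = fentropy mu f.
Proof.
move=> mf; apply: eq_bigr => i _; congr (eta_fn (fine _)).
by rewrite comp_preimage mu_iter_preimage.
Qed.

Lemma cond_fentropy_iter (I J : finType) (f : X -> I) (g : X -> J) n :
  measurable_fibers f -> measurable_fibers g ->
  cond_fentropy mu (f \o iter n T) (g \o iter n T) = cond_fentropy mu f g.
Proof.
move=> mf mg; rewrite /cond_fentropy fentropy_iter//; congr (_ - _).
rewrite -[RHS](fentropy_iter n)//; exact: measurable_fibers_pairf.
Qed.

Lemma block0_entropy (I : finType) (f : X -> I) : fentropy mu (block f 0) = 0.
Proof. by apply: fentropy_cst => x y; apply/eq_blockP. Qed.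

(** Strong subadditivity for time [0], times [1] to [n] in the middle, and time [n.+1]. Invariance
    identifies the shifted blocks with unshifted ones. *)
Lemma block_increment (I : finType) (f : X -> I) n : measurable_fibers f ->
  fentropy mu (block f n.+2) - fentropy mu (block f n.+1) <=
  fentropy mu (block f n.+1) - fentropy mu (block f n).
Proof.
move=> mf.
pose g := block f n \o iter 1 T; pose k := f \o iter n.+1 T.
have mb m : measurable_fibers (block f m) by exact: measurable_fibers_block.
have mg : measurable_fibers g by exact: measurable_fibers_iter.
have mk : measurable_fibers k by exact: measurable_fibers_iter.
have := fentropy_ssa mu mf mg mk.
have -> : fentropy mu g = fentropy mu (block f n) by exact: (fentropy_iter 1 (mb n)).
have -> : fentropy mu (pairf f g) = fentropy mu (block f n.+1).
  apply: (fentropy_eq mu (mb n.+1)) => x y; rewrite eq_blockP /pairf.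
    move=> e; rewrite (e 0%N)//; congr pair; apply/eq_blockP => i ilt.
    by rewrite -!iterD addn1; exact: e.
  move=> [e0 /eq_blockP e] [_|i]; first exact: e0.
  by rewrite ltnS => /e; rewrite -!iterD addn1.
have -> : fentropy mu (pairf g k) = fentropy mu (block f n.+1).
  rewrite -[RHS](fentropy_iter 1 (mb n.+1)); apply: fentropy_eq.
  - exact: (measurable_fibers_iter 1 (mb n.+1)).
  - move=> x y /eq_blockP e; congr pair.
      apply/eq_blockP => i ilt; apply: e; exact: ltnW.
    by have := e n (ltnSn n); rewrite -!iterD addn1.
  - move=> x y [/eq_blockP e en]; apply/eq_blockP => i.
    rewrite ltnS leq_eqVlt => /predU1P[->|/e//].
    by rewrite -!iterD addn1.
have -> : fentropy mu (pairf f (pairf g k)) = fentropy mu (block f n.+2).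
  apply: (fentropy_eq mu (mb n.+2)) => x y; rewrite eq_blockP /pairf.
    move=> e; rewrite (e 0%N)//; congr (_, (_, _)); last exact: e.
    by apply/eq_blockP => i ilt; rewrite -!iterD addn1; apply: e; rewrite ltnS ltnW.
  move=> [e0 /eq_blockP e en] [_|i]; first exact: e0.
  rewrite ltnS ltnS leq_eqVlt => /predU1P[->//|/e].
  by rewrite -!iterD addn1.
by move=> H; lra.
Qed.

(** Increments decrease and the empty block has entropy zero, so the next increment is at most the
    average of the first [n]. *)
Lemma block_increment_le_avg (I : finType) (f : X -> I) n : measurable_fibers f ->
  n%:R * (fentropy mu (block f n.+1) - fentropy mu (block f n)) <=
  fentropy mu (block f n).
Proof.
move=> mf; elim: n => [|n IH]; first by rewrite mul0r block0_entropy.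
have := block_increment n mf.
move: IH; rewrite -natr1; set a := fentropy _ _; set b := fentropy _ _.
set c := fentropy _ _ => IH H.
have : n%:R * (c - a) <= n%:R * (a - b) by apply: ler_wpM2l.
rewrite mulrDl mul1r => H'; lra.
Qed.

(** Clearing denominators gives [block_increment_le_avg]. Monotonicity, more than mere convergence,
    lets a rate at any fixed length bound all later ones. *)
Lemma block_avg_nonincreasing (I : finType) (f : X -> I) : measurable_fibers f ->
  nonincreasing_seq (fun n => n.+1%:R^-1 * fentropy mu (block f n.+1)).
Proof.
move=> mf; apply/nonincreasing_seqP => n.
have := block_increment_le_avg n.+1 mf.
set a := fentropy _ _; set b := fentropy _ _ => H.
rewrite ler_pdivrMl ?ltr0n// mulrCA ler_pdivlMl ?ltr0n//.
by move: H; rewrite -(natr1 n.+1); lra.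
Qed.

(** Induction on the last coordinate: conditioning it on the whole [g]-block is no worse than on [g]
    at the same time, and invariance moves that time to [0]. *)
Lemma block_cond_le (I J : finType) (f : X -> I) (g : X -> J) n :
  measurable_fibers f -> measurable_fibers g ->
  cond_fentropy mu (block f n) (block g n) <= n%:R * cond_fentropy mu f g.
Proof.
move=> mf mg; have mb m : measurable_fibers (block f m) by exact: measurable_fibers_block.
have mc m : measurable_fibers (block g m) by exact: measurable_fibers_block.
elim: n => [|n IH].
  rewrite mul0r /cond_fentropy block0_entropy subr0.
  by rewrite fentropy_cst// => x y; congr pair; apply/eq_blockP.
have mfn := measurable_fibers_iter n mf; have mgn := measurable_fibers_iter n mg.
have -> : cond_fentropy mu (block f n.+1) (block g n.+1) =
    cond_fentropy mu (pairf (block f n) (f \o iter n T)) (block g n.+1).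
  apply: (cond_fentropy_eq mu (measurable_fibers_pairf (mb n) mfn) (mc n.+1)) => //.
  - move=> x y [/eq_blockP e en]; apply/eq_blockP => i.
    by rewrite ltnS leq_eqVlt => /predU1P[->|/e].
  - by move=> x y /eq_blockP e; congr pair;
      [apply/eq_blockP => i ilt; exact/e/ltnW|exact: e].
apply: (le_trans (cond_fentropy_pair_le mu (mb n) mfn (mc n.+1))).
rewrite -natr1 mulrDl mul1r; apply: lerD.
  apply: (le_trans _ IH).
  apply: (cond_fentropy_le_of_determines mu (mb n) (mc n.+1)).
  by move=> x y /eq_blockP e; apply/eq_blockP => i ilt; exact/e/ltnW.
rewrite -(cond_fentropy_iter n mf mg).
apply: (cond_fentropy_le_of_determines mu mfn (mc n.+1)).
by move=> x y /eq_blockP e; exact: e.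
Qed.

Lemma block_entropy_le (I J : finType) (f : X -> I) (g : X -> J) n :
  measurable_fibers f -> measurable_fibers g ->
  fentropy mu (block f n) <=
  fentropy mu (block g n) + n%:R * cond_fentropy mu f g.
Proof.
move=> mf mg.
have mb : measurable_fibers (block f n) by exact: measurable_fibers_block.
have mc : measurable_fibers (block g n) by exact: measurable_fibers_block.
apply: le_trans (fentropy_le_cond mu mb mc) _.
by rewrite lerD2l block_cond_le.
Qed.

(** An [n]-block of [M]-blocks is read off from the [n]-block at time [0] and the [M]-block at time
    [n]. The excess does not depend on [n]. *)
Lemma block_block_le (J : finType) (q : X -> J) M n : measurable_fibers q ->
  fentropy mu (block (block q M) n) <=
  fentropy mu (block q n) + fentropy mu (block q M).
Proof.
move=> mq; have mb m : measurable_fibers (block q m) by exact: measurable_fibers_block.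
rewrite -(fentropy_iter n (mb M)).
apply: le_trans (fentropy_pair_le mu (mb n) (measurable_fibers_iter n (mb M))).
apply: fentropy_le.
  exact: measurable_fibers_pairf (mb n) (measurable_fibers_iter n (mb M)).
move=> x y [/eq_blockP e1 /eq_blockP e2]; apply/eq_blockP => i ilt.
apply/eq_blockP => j jlt; rewrite -!iterD.
have [lt|le] := ltnP (j + i) n; first exact: e1.
have := e2 (j + i - n)%N; rewrite -!iterD subnK//; apply.
by rewrite ltn_subLR// addnC -ltn_subLR; lia.
Qed.

End BlockEntropy.

(** * Approximation by a generator *)

Section SymmetricDifference.
Context {d : measure_display} {X : measurableType d} {R : realType}.
Implicit Types (mu : probability X R) (A B C : set X).

Definition symdiff A B : set X := (A `\` B) `|` (B `\` A).

Definition indicb A (x : X) : bool := `[< A x >].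

Lemma indicb_eqP A x y : indicb A x = indicb A y <-> (A x <-> A y).
Proof.
split => [e|]; last exact: asbool_equiv_eq.
by split => h; apply/asboolP; move: e; rewrite /indicb; [move=> <-|move=> ->];
  exact/asboolP.
Qed.

Lemma measurable_symdiff A B : measurable A -> measurable B ->
  measurable (symdiff A B).
Proof. by move=> mA mB; apply: measurableU; exact: measurableD. Qed.

Lemma fine_muU_le mu A B : measurable A -> measurable B ->
  fine (mu (A `|` B)) <= fine (mu A) + fine (mu B).
Proof.
move=> mA mB; rewrite -fineD ?fin_num_measure//.
apply: fine_le; last exact: measureU2.
  by rewrite fin_num_measure//; exact: measurableU.
by rewrite fin_numD !fin_num_measure.
Qed.

Lemma symdiff_triangle mu A B C : measurable A -> measurable B -> measurable C ->
  fine (mu (symdiff A C)) <= fine (mu (symdiff A B)) + fine (mu (symdiff B C)).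
Proof.
move=> mA mB mC; apply: le_trans (fine_muU_le mu _ _); [|exact: measurable_symdiff..].
apply: fine_mu_le; [exact: measurable_symdiff| |].
  by apply: measurableU; exact: measurable_symdiff.
move=> x; rewrite /symdiff/=; have [Bx|nBx] := pselect (B x); tauto.
Qed.

Lemma indicb_preimage A b : indicb A @^-1` [set b] = if b then A else ~` A.
Proof.
apply/seteqP; split => x; rewrite /indicb/=.
  by case: b => /asboolP.
by case: b => h; [exact/asboolP|apply/asboolP].
Qed.

Lemma measurable_fibers_indicb A : measurable A -> measurable_fibers (indicb A).
Proof. by move=> mA [|]; rewrite indicb_preimage//; exact: measurableC. Qed.

(** By [eta_le_sqrt] the set contributes at most [2 * e]; by [eta_le_sub] its complement contributes
    at most [e ^+ 2 <= e]. *)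
Lemma fentropy_indicb mu A e : measurable A -> fine (mu A) <= e ^+ 2 -> 0 <= e <= 1 ->
  fentropy mu (indicb A) <= 3 * e.
Proof.
move=> mA Ae /andP[e0 e1]; rewrite /fentropy big_bool !indicb_preimage/= fine_muC//.
have /andP[a0 a1] := fine_mu_itv mu mA.
have sqA : Num.sqrt (fine (mu A)) <= e.
  by rewrite -(ger0_norm e0) -sqrtr_sqr ler_wsqrtr.
have cA0 : 0 <= 1 - fine (mu A) by lra.
have e2 : e ^+ 2 <= e by rewrite expr2 ler_piMl.
have hA := eta_le_sqrt a0; have hC := eta_le_sub cA0; lra.
Qed.

(** Conditioning on [g] is replaced by conditioning on [B]. Given [B], the set [A] is recovered from
    [symdiff A B], whose entropy is small. *)
Lemma cond_fentropy_indicb mu (J : finType) (g : X -> J) A B e :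
  measurable_fibers g -> measurable A ->
  (forall x y, g x = g y -> B x -> B y) ->
  fine (mu (symdiff A B)) <= e ^+ 2 -> 0 <= e <= 1 ->
  cond_fentropy mu (indicb A) g <= 3 * e.
Proof.
move=> mg mA sB AB e01; have mB := measurable_saturated mg sB.
have iA := measurable_fibers_indicb mA; have iB := measurable_fibers_indicb mB.
have mD := measurable_symdiff mA mB; have iD := measurable_fibers_indicb mD.
apply: le_trans (cond_fentropy_le_of_determines mu iA mg (k := indicb B) _) _.
  by move=> x y gxy; apply/indicb_eqP; split; exact: sB.
apply: le_trans (fentropy_indicb mD AB e01); rewrite /cond_fentropy lerBlDr.
apply: le_trans (fentropy_pair_le mu iD iB).
apply: fentropy_le; first exact: measurable_fibers_pairf.
move=> x y; rewrite /pairf => -[/indicb_eqP eD eB].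
rewrite eB; congr pair; move/indicb_eqP: eB => eB.
apply/indicb_eqP; move: eD eB; rewrite /symdiff/=.
have [Bx|nBx] := pselect (B x); have [Ax|nAx] := pselect (A x);
  have [Ay|nAy] := pselect (A y); tauto.
Qed.

Lemma cond_fentropy_le_l mu (I I' J : finType) (f : X -> I) (f' : X -> I') (g : X -> J) :
  measurable_fibers f -> measurable_fibers g -> determines f f' ->
  cond_fentropy mu f' g <= cond_fentropy mu f g.
Proof.
move=> mf mg ff'; rewrite lerD2r; apply: fentropy_le.
  exact: measurable_fibers_pairf.
by move=> x y [/ff' fxy gxy]; rewrite /pairf fxy gxy.
Qed.

Lemma cond_fentropy_le_sum mu (I J : finType) (f : X -> I) (g : X -> J) :
  measurable_fibers f -> measurable_fibers g ->
  cond_fentropy mu f g <=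
  \sum_i cond_fentropy mu (indicb (f @^-1` [set i])) g.
Proof.
move=> mf mg.
(* [F s] records the indicators of the values in [s] only; the fixed codomain permits induction on
   [s]. *)
pose F (s : seq I) (x : X) : {ffun I -> bool} := [ffun i => (i \in s) && (f x == i)].
have mF s : measurable_fibers (F s).
  by apply: (measurable_fibers_determined mf) => x y; rewrite /F => ->.
have Fs s : cond_fentropy mu (F s) g <=
    \sum_(i <- s) cond_fentropy mu (indicb (f @^-1` [set i])) g.
  elim: s => [|i s IH].
    have gF : determines g (F [::]) by move=> x y _; apply/ffunP => i; rewrite !ffunE.
    by rewrite big_nil /cond_fentropy (fentropy_determined_pair mu gF) subrr.
  have mi : measurable_fibers (indicb (f @^-1` [set i])).
    exact/measurable_fibers_indicb/mf.
  rewrite big_cons; apply: le_trans (lerD (lexx _) IH).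
  apply: le_trans (cond_fentropy_pair_le mu mi (mF s) mg).
  apply: (cond_fentropy_le_l mu (measurable_fibers_pairf mi (mF s)) mg).
  move=> x y; rewrite /pairf => -[/indicb_eqP/= e1 e2].
  apply/ffunP => k; have := congr1 (fun h : {ffun I -> bool} => h k) e2.
  rewrite !ffunE inE.
  have [->|//] := eqVneq k i; rewrite /= => _.
  by apply/eqP/eqP => /e1.
apply: le_trans (Fs (index_enum I)).
apply: (cond_fentropy_le_l mu (mF (index_enum I)) mg) => x y.
move=> /(congr1 (fun h : {ffun I -> bool} => h (f x))).
by rewrite !ffunE mem_index_enum/= eqxx => /esym/eqP.
Qed.

End SymmetricDifference.

(** * Approximation of measurable sets by finite windows, and the generator theorem *)

Section Generator.
Context {d : measure_display} {X : measurableType d} {R : realType}.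
Context (mu : probability X R) (T S : X -> X).
Hypotheses (mT : measurable_fun setT T) (mS : measurable_fun setT S).
Hypotheses (invT : T_invariant mu T) (TS : cancel T S).
Context (a : X -> nat).
Hypothesis ma : measurable_fibers a.

Definition trunc (k : nat) (x : X) : 'I_k.+1 := inord (minn (a x) k).

Lemma trunc_eqP k x y : trunc k x = trunc k y <-> minn (a x) k = minn (a y) k.
Proof.
split => [/(congr1 val)|]; last by rewrite /trunc => ->.
by rewrite /trunc/= !inordK// ltnS geq_minr.
Qed.

Lemma trunc_determined k l : (k <= l)%N -> determines (trunc l) (trunc k).
Proof. by move=> kl x y /trunc_eqP e; apply/trunc_eqP; lia. Qed.

Lemma measurable_fibers_trunc k : measurable_fibers (trunc k).
Proof. by apply: (measurable_fibers_determined ma) => x y; rewrite /trunc => ->. Qed.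

(* One index [N] serves as truncation level, time shift and half the window
   length; shifting by [N] makes the two-sided generator one-sided. *)
Definition approx (A : set X) (N : nat) (e : R) : Prop := exists2 B : set X,
  forall x y, block T (trunc N) N.*2 x = block T (trunc N) N.*2 y -> B x -> B y
  & fine (mu (symdiff (iter N T @^-1` A) B)) <= e.

(** The class of good sets, shown below to be a sigma-algebra containing all shifted fibres of
    [a]. *)
Definition approximable (A : set X) : Prop :=
  measurable A /\ forall e : R, 0 < e -> exists N, approx A N e.

Lemma measurable_block_trunc N M : measurable_fibers (block T (trunc N) M).
Proof. by apply: measurable_fibers_block => //; exact: measurable_fibers_trunc. Qed.

(** The approximating set is pulled back by [T^(N' - N)]: its window then lies inside the longer
    one, and invariance preserves the error. *)
Lemma approx_mono A N N' e : measurable A -> (N <= N')%N ->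
  approx A N e -> approx A N' e.
Proof.
move=> mA NN' [B sB AB]; have mB := measurable_saturated (@measurable_block_trunc N _) sB.
exists (iter (N' - N) T @^-1` B).
  move=> x y /eq_blockP e'; apply: sB; apply/eq_blockP => i ilt.
  rewrite -!iterD; apply: (trunc_determined NN'); apply: e'.
  by move: ilt; rewrite -!addnn; lia.
apply: le_trans AB.
have mD := measurable_symdiff (measurable_iter_preimage mT N mA) mB.
rewrite -[leRHS](congr1 _ (mu_iter_preimage mT invT (N' - N) mD)).
rewrite (_ : symdiff _ _ = iter (N' - N) T @^-1` symdiff (iter N T @^-1` A) B)//.
by apply/seteqP; split=> x; rewrite /symdiff/= -iterD subnKC.
Qed.

Lemma approximable_max (A B : set X) e : 0 < e -> approximable A -> approximable B ->
  exists N, approx A N e /\ approx B N e.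
Proof.
move=> e0 [mA /(_ _ e0)[N AN]] [mB /(_ _ e0)[M BM]]; exists (maxn N M).
by split; [apply: approx_mono AN|apply: approx_mono BM]; rewrite ?leq_maxl ?leq_maxr.
Qed.

Lemma approximable0 : approximable set0.
Proof.
split=> // e e0; exists 0%N, set0 => //.
by rewrite preimage_set0 /symdiff setDv setU0 measure0/= ltW.
Qed.

Lemma approximableC A : approximable A -> approximable (~` A).
Proof.
move=> [mA hA]; split; first exact: measurableC.
move=> e /hA[N [B sB AB]]; exists N, (~` B).
  by move=> x y xy + By; apply; exact: sB (esym xy) By.
suff -> : symdiff (iter N T @^-1` (~` A)) (~` B) = symdiff (iter N T @^-1` A) B by [].
apply/seteqP; split=> x; rewrite /symdiff/=;
  have [Bx|nBx] := pselect (B x); have [Ax|nAx] := pselect (A (iter N T x)); tauto.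
Qed.

Lemma approximableU A B : approximable A -> approximable B -> approximable (A `|` B).
Proof.
move=> hA hB; split; first by case: hA hB => mA _ [mB _]; exact: measurableU.
move=> e e0; have e20 : 0 < e / 2 by rewrite divr_gt0.
have [N [[A' sA AA'] [B' sB BB']]] := approximable_max e20 hA hB.
have mA' := measurable_saturated (@measurable_block_trunc N _) sA.
have mB' := measurable_saturated (@measurable_block_trunc N _) sB.
have mA := measurable_iter_preimage mT N hA.1.
have mB := measurable_iter_preimage mT N hB.1.
exists N, (A' `|` B').
  by move=> x y xy [/(sA _ _ xy)|/(sB _ _ xy)]; [left|right].
have mAA' := measurable_symdiff mA mA'; have mBB' := measurable_symdiff mB mB'.
apply: (@le_trans _ _ (fine (mu (symdiff (iter N T @^-1` A) A' `|`
                                 symdiff (iter N T @^-1` B) B')))).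
  apply: fine_mu_le; [|exact: measurableU|].
    by apply: measurable_symdiff; rewrite ?preimage_setU; exact: measurableU.
  by move=> x; rewrite /symdiff/=; tauto.
apply: le_trans (fine_muU_le mu mAA' mBB') _.
by rewrite [leRHS]splitr lerD.
Qed.

Lemma approximable_close A : measurable A ->
  (forall e, 0 < e -> exists2 B, approximable B & fine (mu (symdiff A B)) <= e) ->
  approximable A.
Proof.
move=> mA hA; split=> // e e0; have e20 : 0 < e / 2 by rewrite divr_gt0.
have [B [mB hB] AB] := hA _ e20; have [N [C sC BC]] := hB _ e20.
have mC := measurable_saturated (@measurable_block_trunc N _) sC.
exists N, C => //; have mA' := measurable_iter_preimage mT N mA.
have mB' := measurable_iter_preimage mT N mB.
apply: le_trans (symdiff_triangle mu mA' mB' mC) _.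
rewrite [leRHS]splitr lerD//.
rewrite (_ : symdiff _ _ = iter N T @^-1` symdiff A B)// mu_iter_preimage//.
exact: measurable_symdiff.
Qed.

(** Finite unions are approximable, and by continuity from below they exhaust the countable union up
    to small measure. *)
Lemma approximable_bigcup (F : nat -> set X) :
  (forall n, approximable (F n)) -> approximable (\bigcup_n F n).
Proof.
move=> hF; have mF n := (hF n).1.
have mUF : measurable (\bigcup_n F n) by exact: bigcupT_measurable.
apply: approximable_close => // e e0.
pose U n := \big[setU/set0]_(i < n) F i.
have hU n : approximable (U n).
  rewrite /U; elim: n => [|n IH]; first by rewrite big_ord0; exact: approximable0.
  by rewrite big_ord_recr; exact: approximableU.
have UF : \bigcup_n U n = \bigcup_n F n.
  apply/seteqP; split => [x [n _]|x [n _ Fnx]].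
    by rewrite /U -bigcup_mkord => -[i _ Fi]; exists i.
  by exists n.+1 => //; rewrite /U -bigcup_mkord; exists n => /=.
have : mu \o U @ \oo --> mu (\bigcup_n U n).
  apply: nondecreasing_cvg_mu; [by move=> n; exact: (hU n).1|by rewrite UF|].
  by move=> m n mn; apply/subsetPset; exact: subset_bigsetU.
rewrite UF -[mu (\bigcup_n F n)]fineK ?fin_num_measure// => /fine_cvg.
move=> /cvgrPdist_le/(_ _ e0)[n _ /(_ n (leqnn n))/= Hn].
exists (U n) => //; apply: le_trans Hn; apply: le_trans (ler_norm _).
have sU : U n `<=` \bigcup_n F n by rewrite -UF; exact: bigcup_sup.
rewrite /symdiff (_ : U n `\` _ = set0) ?setU0; last by rewrite setD_eq0.
have := measureD mUF (hU n).1; rewrite setIidr// => -> //; last first.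
  by rewrite ltey_eq fin_num_measure.
by rewrite fineB// fin_num_measure//; exact: (hU n).1.
Qed.

Lemma approximable_sigma_algebra : sigma_algebra setT approximable.
Proof.
split; [exact: approximable0|by move=> A /approximableC; rewrite setTD|].
exact: approximable_bigcup.
Qed.

Lemma approximable_exact A N : measurable A ->
  (forall x y, block T (trunc N) N.*2 x = block T (trunc N) N.*2 y ->
    A (iter N T x) -> A (iter N T y)) -> approximable A.
Proof.
move=> mA sA; split=> // e e0; exists N, (iter N T @^-1` A) => //.
by rewrite /symdiff setDv setU0 measure0/= ltW.
Qed.

Lemma measurable_iterS n A : measurable A -> measurable (iter n S @^-1` A).
Proof. exact: measurable_iter_preimage. Qed.

Lemma approximable_iterT i j : approximable (iter i T @^-1` (a @^-1` [set j])).
Proof.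
(* [N > j] makes the truncation recognise the value [j]; [N > i] puts time [i + N] inside the window
   of length [N.*2]. *)
apply: (@approximable_exact _ (maxn i.+1 j.+1)); first exact/measurable_iter_preimage/ma.
move=> x y /eq_blockP e; rewrite /= -!iterD => ax.
have ilt : (i + maxn i.+1 j.+1 < (maxn i.+1 j.+1).*2)%N by rewrite -addnn; lia.
by have /trunc_eqP := e _ ilt; rewrite ax; lia.
Qed.

Lemma iterST i N x : (i <= N)%N -> iter i S (iter N T x) = iter (N - i) T x.
Proof.
elim: i => [|i IH] iN; first by rewrite subn0.
by rewrite iterS IH ?(ltnW iN)// -(subnSK iN) iterS TS.
Qed.

Lemma approximable_iterS i j : approximable (iter i S @^-1` (a @^-1` [set j])).
Proof.
(* After the shift by [N >= i], the backward time [-i] becomes the time [N - i], which the window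
   contains. *)
apply: (@approximable_exact _ (maxn i j.+1)); first exact/measurable_iterS/ma.
have iN : (i <= maxn i j.+1)%N by rewrite leq_maxl.
move=> x y /eq_blockP e; rewrite /= !iterST// => ax.
have ilt : (maxn i j.+1 - i < (maxn i j.+1).*2)%N by rewrite -addnn; lia.
by have /trunc_eqP := e _ ilt; rewrite ax; lia.
Qed.

Lemma generator_approximable (P : set (set X)) :
  (forall c, P c -> c = set0 \/ exists j, c = a @^-1` [set j]) ->
  is_generator mu T S P -> forall A, measurable A -> approximable A.
Proof.
move=> hP gen A mA; have [B [sB AB]] := gen _ mA.
have aB : approximable B.
  (* The generated sigma-algebra is the least one, so it suffices that the approximable sets form a
     sigma-algebra containing the generating sets. *)
  apply: sB; split; first exact: approximable_sigma_algebra.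
  move=> _ [k _ [|] [c /hP[->|[j ->]] <-]]; rewrite ?preimage_set0.
  - exact: approximable0.
  - exact: approximable_iterS.
  - exact: approximable0.
  - exact: approximable_iterT.
apply: approximable_close => // e e0; exists B => //.
by rewrite AB/= ltW.
Qed.

Lemma approximable_cond_fentropy (I : finType) (f : X -> I) (e : R) : 0 < e ->
  measurable_fibers f -> (forall i, approximable (f @^-1` [set i])) ->
  exists N, cond_fentropy mu (f \o iter N T) (block T (trunc N) N.*2) <= e.
Proof.
move=> e0 mf hf.
(* Each fibre costs at most [3 * c], so all of them cost at most [e]; the successor avoids a
   division by zero, and [c <= 1] is required by [cond_fentropy_indicb]. *)
pose c := Num.min 1 (e / (3 * #|I|.+1%:R)).
have c0 : 0 < c by rewrite lt_min ltr01/= divr_gt0// mulr_gt0// ltr0n.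
have c1 : c <= 1 by rewrite ge_min lexx.
have ce : c * (3 * #|I|.+1%:R) <= e.
  by rewrite -ler_pdivlMr ?mulr_gt0 ?ltr0n// ge_min lexx orbT.
have c20 : 0 < c ^+ 2 by rewrite exprn_gt0.
have /choice[N hN] : forall i, exists N, approx (f @^-1` [set i]) N (c ^+ 2).
  by move=> i; exact: (hf i).2.
exists (\max_i N i).
have mfN := measurable_fibers_iter mT (\max_i N i) mf.
have mg := @measurable_block_trunc (\max_i N i) (\max_i N i).*2.
apply: le_trans (cond_fentropy_le_sum mu mfN mg) _.
apply: (@le_trans _ _ (\sum_(i : I) (3 * c))).
  apply: ler_sum => i _.
  have [B sB AB] := approx_mono (mf i) (leq_bigmax i) (hN i).
  apply: (cond_fentropy_indicb mg (mfN i) sB AB).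
  by rewrite (ltW c0) c1.
rewrite sumr_const; apply: le_trans ce.
have -> : (3 * c) *+ #|I| = c * (3 * #|I|%:R) by rewrite -mulr_natl; ring.
by rewrite ler_pM2l// ler_pM2l// ler_nat.
Qed.

(** The index matches [part_ks_entropy]: index [n] has block length [n.+1]. *)
Definition block_rate (I : finType) (f : X -> I) (n : nat) : R :=
  n.+1%:R^-1 * fentropy mu (block T f n.+1).

(* The Kolmogorov-Sinai generator theorem, before passing to the limit. *)
Lemma generator_block_rate_le (P : set (set X)) (I : finType) (f : X -> I) (e : R) :
  (forall c, P c -> c = set0 \/ exists j, c = a @^-1` [set j]) ->
  is_generator mu T S P -> 0 < e -> measurable_fibers f ->
  exists N, forall r, exists n, block_rate f n <= block_rate (trunc N) r + e.
Proof.
move=> hP gen e0 mf; have e20 : 0 < e / 2 by rewrite divr_gt0.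
have [N hN] := approximable_cond_fentropy e20 mf
  (fun i => generator_approximable hP gen (mf i)).
exists N => r; have mq := @measurable_fibers_trunc N.
set C := fentropy mu (block T (trunc N) N.*2).
have C0 : 0 <= C by apply: fentropy_ge0; exact: measurable_block_trunc.
(* The first summand gives [n >= r] for monotonicity of the rates; the second makes the boundary
   cost [C / n.+1] at most [e / 2]. *)
pose n := (r + Num.bound (C / (e / 2)))%N.
exists n.
have Cn : n.+1%:R^-1 * C <= e / 2.
  rewrite ler_pdivrMl ?ltr0n// -ler_pdivrMr//.
  apply: le_trans (ltW (archi_boundP _)) _; first by rewrite divr_ge0// ltW.
  by rewrite ler_nat leqW// leq_addl.
have rn : block_rate (trunc N) n <= block_rate (trunc N) r.
  by apply: (block_avg_nonincreasing mT invT mq); rewrite /n leq_addr.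
have mfN := measurable_fibers_iter mT N mf.
have mbN := @measurable_block_trunc N N.*2.
have key := block_entropy_le mT invT n.+1 mfN mbN.
have key2 := block_block_le mT invT N.*2 n.+1 mq.
(* The shift by [N] commutes with forming blocks, and invariance removes it. *)
have eqf : fentropy mu (block T (f \o iter N T) n.+1) = fentropy mu (block T f n.+1).
  rewrite -[RHS](fentropy_iter mT invT N); last exact: measurable_fibers_block.
  congr fentropy; apply/funext => x; apply/ffunP => i; rewrite !ffunE/=.
  by rewrite -!iterD addnC.
rewrite eqf in key.
apply: (@le_trans _ _ (block_rate (trunc N) n + n.+1%:R^-1 * C + e / 2)); last first.
  by rewrite [in leRHS](splitr e) addrA lerD2r lerD.
rewrite /block_rate -mulrDr ler_pdivrMl ?ltr0n// [leRHS]mulrDr mulVKf ?pnatr_eq0//.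
apply: (le_trans key); apply: lerD => //.
by rewrite ler_pM2l ?ltr0n.
Qed.

End Generator.

(** * Partitions and their codings *)

Section Coding.
Context {d : measure_display} {X : measurableType d} {R : realType}.
Implicit Types (mu : probability X R) (P : set (set X)) (T : X -> X).

(* [f] separates the points of [X] exactly as the nonempty atoms of [P] do;
   [set0] may or may not belong to [P]. *)
Definition codes (I : Type) (f : X -> I) P : Prop :=
  forall A x, A x -> P A <-> A = f @^-1` [set f x].

(** Joins may contain the empty set as an intersection of disjoint atoms; [codes] tests only sets
    with a point, so the induction never meets it. *)
Lemma codes_iter_join (I : Type) (f : X -> I) T P n :
  codes f P -> codes (block T f n.+1) (iter_join T P n).
Proof.
move=> fP; elim: n => [|n IH] A x Ax.
  rewrite (_ : _ @^-1` _ = f @^-1` [set f x]); first exact: fP.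
  apply/seteqP; split=> y /=; first by move=> /eq_blockP/(_ 0%N isT).
  by move=> fxy; apply/eq_blockP => -[|].
have E : block T f n.+2 @^-1` [set block T f n.+2 x] =
    block T f n.+1 @^-1` [set block T f n.+1 x] `&`
    iter n.+1 T @^-1` (f @^-1` [set f (iter n.+1 T x)]).
  apply/seteqP; split=> y /=.
    move=> /eq_blockP e; split; last exact: e n.+1 (ltnSn _).
    by apply/eq_blockP => i ilt; apply: e; exact: ltnW.
  move=> [/eq_blockP e en]; apply/eq_blockP => i.
  by rewrite ltnS leq_eqVlt => /predU1P[->//|/e].
rewrite E /=; split.
  move=> [A1 PA1 [_ [A2 PA2 <-] AE]]; move: Ax; rewrite -AE => -[A1x A2x].
  by congr (_ `&` _); [apply/(IH _ x)|congr (_ @^-1` _); apply/(fP _ (iter n.+1 T x))].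
move=> ->; exists (block T f n.+1 @^-1` [set block T f n.+1 x]).
  by apply/(IH _ x).
exists (iter n.+1 T @^-1` (f @^-1` [set f (iter n.+1 T x)])) => //.
by exists (f @^-1` [set f (iter n.+1 T x)]) => //; apply/(fP _ (iter n.+1 T x)).
Qed.

(** Nonempty atoms correspond bijectively to the values taken by [f]; an empty atom and the values
    not taken contribute [eta_fn 0 = 0]. *)
Lemma part_entropy_codes_esum mu (I : choiceType) (f : X -> I) P :
  measurable_fibers f -> codes f P ->
  part_entropy mu P =
  (\esum_(i in [set: I]) (eta_fn (fine (mu (f @^-1` [set i]))))%:E)%E.
Proof.
move=> mf fP; rewrite /part_entropy.
have eta_set0 : (eta_fn (fine (mu set0)))%:E = 0%E :> \bar R.
  by rewrite measure0 eta0.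
have mP A : P A -> measurable A.
  move=> PA; have [[x Ax]|/set0P/negP/negPn/eqP->//] := pselect (A !=set0).
  by rewrite ((fP _ _ Ax).1 PA); exact: mf.
rewrite (esumID [set~ set0]); last first.
  by move=> A /mP mA; rewrite lee_fin eta_ge0// fine_mu_itv.
rewrite [X in (_ + X)%E]esum1 ?adde0; last first.
  by move=> A [_ /=] /contrapT ->.
pose D := [set i | exists x, f x = i].
have -> : P `&` [set~ set0] = (fun i => f @^-1` [set i]) @` D.
  apply/seteqP; split => [A [PA /eqP/set0P[x Ax]]|_ [_ [x <-] <-]].
    by exists (f x); [exists x|rewrite ((fP _ _ Ax).1 PA)].
  split; first exact/(fP _ x).
  by move=> /seteqP[/(_ x erefl)].
rewrite esum_image; last first.
  by move=> i j /set_mem[x <-] _ /seteqP[/(_ x erefl)].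
rewrite esum_mkcond; apply: eq_esum => i _.
case: ifPn => //; rewrite notin_setE => nD.
rewrite (_ : f @^-1` [set i] = set0) ?eta_set0// -subset0 => x /= fx.
by apply: nD; exists x.
Qed.

Lemma part_entropy_codes mu (I : finType) (f : X -> I) P :
  measurable_fibers f -> codes f P -> part_entropy mu P = (fentropy mu f)%:E.
Proof.
move=> mf fP; rewrite (part_entropy_codes_esum mu mf fP).
rewrite (esum_fset finite_finset); last first.
  by move=> i _; rewrite lee_fin eta_ge0 ?fine_mu_itv//; exact: mf.
rewrite /fentropy; rewrite -sumEFin (fsbig_seq _ _ (index_enum_uniq I)).
by apply: eq_fsbigl; apply/seteqP; split => i //= _; rewrite mem_index_enum.
Qed.

(** A point is sent to the label under [c] of the atom containing it. *)
Lemma partition_codes (J : Type) P (c : set X -> J) : is_partition P ->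
  (forall A B, P A -> P B -> c A = c B -> A = B) ->
  exists2 f : X -> J, codes f P & measurable_fibers f.
Proof.
move=> [_ mP dP cP] cinj.
have /choice[atom hatom] : forall x, exists A, P A /\ A x.
  move=> x; have : [set: X] x by [].
  by rewrite -cP => -[A PA Ax]; exists A.
have atomE A x : P A -> A x -> atom x = A.
  move=> PA Ax; have [Pa ax] := hatom x.
  apply: contrapT => ne; have := dP _ _ Pa PA ne.
  by move=> /seteqP[/(_ x (conj ax Ax))].
have fiberE x : (c \o atom) @^-1` [set c (atom x)] = atom x.
  have [Px ax] := hatom x; apply/seteqP; split => y /=.
    have [Py ay] := hatom y.
    by move=> /(cinj _ _ Py Px) <-.
  by move=> /(atomE _ _ Px) ->.
exists (c \o atom).
  move=> A x Ax; rewrite fiberE; split => [PA|->]; first by rewrite (atomE A).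
  exact: (hatom x).1.
move=> j; have [[x <-]|nx] := pselect (exists x, c (atom x) = j).
  by rewrite fiberE; apply: mP; exact: (hatom x).1.
rewrite (_ : _ @^-1` _ = set0)// -subset0 => x /= fx.
by apply: nx; exists x.
Qed.

Lemma countable_partition_codes P : is_partition P ->
  exists2 f : X -> nat, codes f P & measurable_fibers f.
Proof.
move=> pP; have [/countable_injP[c cinj] _ _ _] := pP.
by apply: (partition_codes pP (c := c)) => A B PA PB; apply: cinj; rewrite inE.
Qed.

Lemma finite_partition_codes P : is_partition P -> finite_set P ->
  exists (I : finType), exists2 f : X -> I, codes f P & measurable_fibers f.
Proof.
move=> pP /finite_seqP[s Ps].
exists 'I_(size s).+1; apply: (partition_codes pP (c := fun A => inord (index A s))).
move=> A B; rewrite Ps /= => As Bs /(congr1 val).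
rewrite /= !inordK ?ltnS ?index_size// => e.
by rewrite -(nth_index set0 As) e nth_index.
Qed.

Lemma fibers_codes (I : Type) (f : X -> I) :
  codes f (range (fun i => f @^-1` [set i])).
Proof.
move=> A x Ax; split => [[i _ Ai]|->]; last by exists (f x).
by move: Ax; rewrite -Ai /= => ->.
Qed.

Lemma fibers_partition (I : finType) (f : X -> I) : measurable_fibers f ->
  is_partition (range (fun i => f @^-1` [set i])) /\
  finite_set (range (fun i => f @^-1` [set i])).
Proof.
move=> mf; have fin : finite_set (range (fun i => f @^-1` [set i])).
  exact: finite_image.
split=> //; split; first exact: finite_set_countable.
- by move=> _ [i _ <-].
- move=> _ _ [i _ <-] [j _ <-] ne; rewrite -subset0 => x /= [fi fj].
  by apply: ne; rewrite -fi -fj.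
- by apply/seteqP; split=> // x _; exists (f @^-1` [set f x]) => //; exists (f x).
Qed.

End Coding.

(** * Block rates and the Kolmogorov-Sinai entropy *)

Section RateLimit.
Context {d : measure_display} {X : measurableType d} {R : realType}.
Context (mu : probability X R) (T : X -> X).
Hypotheses (mT : measurable_fun setT T) (invT : T_invariant mu T).

Lemma block_rate_ge0 (I : finType) (f : X -> I) n : measurable_fibers f ->
  0 <= block_rate mu T f n.
Proof.
move=> mf; rewrite mulr_ge0 ?invr_ge0// fentropy_ge0//.
exact: measurable_fibers_block.
Qed.

Lemma block_rate_cvg (I : finType) (f : X -> I) : measurable_fibers f ->
  cvgn (block_rate mu T f).
Proof.
move=> mf; apply: nonincreasing_is_cvgn.
  exact: block_avg_nonincreasing mf.
by exists 0 => _ [n _ <-]; exact: block_rate_ge0.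
Qed.

Lemma part_ks_entropy_codes (I : finType) (f : X -> I) P :
  measurable_fibers f -> codes f P ->
  part_ks_entropy mu T P = (limn (block_rate mu T f))%:E.
Proof.
move=> mf fP; rewrite -EFin_lim; last exact: block_rate_cvg.
rewrite /part_ks_entropy; congr (limn _); apply/funext => n /=.
have mb : measurable_fibers (block T f n.+1) by exact: measurable_fibers_block.
by rewrite (part_entropy_codes mu mb (codes_iter_join T n fP)).
Qed.

Lemma limn_block_rate_le (I : finType) (f : X -> I) n : measurable_fibers f ->
  limn (block_rate mu T f) <= block_rate mu T f n.
Proof.
move=> mf; apply: nonincreasing_cvgn_ge; last exact: block_rate_cvg.
exact: block_avg_nonincreasing mf.
Qed.

Lemma block_rate_le_ks (I : finType) (f : X -> I) (K e : R) : measurable_fibers f ->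
  (ks_entropy mu T <= K%:E)%E -> 0 < e ->
  exists N, forall n, (N <= n)%N -> block_rate mu T f n <= K + e.
Proof.
move=> mf hK e0.
have limK : limn (block_rate mu T f) <= K.
  rewrite -lee_fin -(part_ks_entropy_codes mf (fibers_codes f)).
  apply: le_trans hK; apply: ereal_sup_ubound.
  by exists (range (fun i => f @^-1` [set i])) => //; exact: fibers_partition.
have /cvgrPdist_le/(_ _ e0)[N _ hN] := block_rate_cvg mf.
exists N => n /hN /=; rewrite distrC => /(le_trans (ler_norm _)).
by rewrite lerBlDl => /le_trans; apply; rewrite lerD2r.
Qed.

End RateLimit.

(** * Comparison of the measures *)

Section Comparison.
Context {d : measure_display} {X : measurableType d} {R : realType}.
Implicit Types (mu nu : probability X R) (P : set (set X)).

(** The set is a disjoint union of fibres of [g], enumerated through [pickle], and the bounds on the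
    fibres add up. *)
Lemma measure_saturated_le mu nu (J : countType) (g : X -> J) (c : R) (B : set X) :
  measurable_fibers g -> 0 <= c ->
  (forall x, mu (g @^-1` [set g x]) <= c%:E * nu (g @^-1` [set g x]))%E ->
  (forall x y, g x = g y -> B x -> B y) -> (mu B <= c%:E * nu B)%E.
Proof.
move=> mg c0 le_c sB.
pose F n := if pselect (exists2 x, B x & pickle (g x) = n)
  then [set x | pickle (g x) = n] else set0.
have fiberE x : [set y | pickle (g y) = pickle (g x)] = g @^-1` [set g x].
  by apply/seteqP; split=> y /=; [move=> /(pcan_inj pickleK)|move=> ->].
have mF n : measurable (F n).
  rewrite /F; case: pselect => [h|h] /=; last exact: measurable0.
  by case: h => x Bx <-; rewrite fiberE; exact: mg.
have tF : trivIset setT F.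
  move=> i j _ _ [x []]; rewrite /F.
  by case: pselect => // h /= <-; case: pselect => // h' /= <-.
have BF : B = \bigcup_n F n.
  apply/seteqP; split=> [x Bx|x [n _]]; rewrite /F.
    by exists (pickle (g x)) => //; case: pselect => // -[]; exists x.
  case: pselect => // h /=; case: h => y By <- /(pcan_inj pickleK) gxy.
  exact: sB (esym gxy) By.
rewrite BF !measure_semi_bigcup//; [|exact: bigcupT_measurable..].
rewrite -nneseriesZl; last by move=> n _; exact: measure_ge0.
apply: lee_nneseries => [n _ _|n _]; first exact: measure_ge0.
rewrite /F; case: pselect => [h|h] /=; last by rewrite !measure0 mule0.
by case: h => x Bx <-; rewrite fiberE; exact: le_c.
Qed.

(** From [ln (1 + e) <= e] follows [- ln q <= - ln p + e]; then [q] is replaced by [(1 - e)^-1 * p]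
    in front of [- ln p >= 0]. *)
Lemma eta_comparison (p q e : R) : 0 < e < 1 -> 0 <= q <= 1 -> 0 <= p <= 1 ->
  (1 - e) * q <= p -> p <= (1 + e) * q ->
  eta_fn q <= (1 - e)^-1 * eta_fn p + q * e.
Proof.
move=> /andP[e0 e1] /andP[q0 q1] p01 pq qp.
have e1' : 0 < 1 - e by lra.
move: q0; rewrite le_eqVlt => /predU1P[q0|q0].
  by rewrite -q0 eta0 mul0r addr0 mulr_ge0 ?eta_ge0// invr_ge0 ltW.
have p0 : 0 < p by apply: lt_le_trans pq; exact: mulr_gt0.
have lnp : ln p <= ln q + e.
  apply: (@le_trans _ _ (ln ((1 + e) * q))).
    by rewrite ler_ln ?posrE//; exact: lt_le_trans qp.
  rewrite lnM ?posrE//; last by lra.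
  by rewrite addrC lerD2l; apply: le_ln1Dx; lra.
have lnp0 : ln p <= 0 by apply: ln_le0; case/andP: p01.
have qp' : q <= (1 - e)^-1 * p by rewrite ler_pdivlMl.
have h1 : q * ln p <= q * (ln q + e) by rewrite ler_pM2l.
have h2 : q * - ln p <= (1 - e)^-1 * p * - ln p by rewrite ler_wpM2r// oppr_ge0.
rewrite /eta_fn -(mulrN p) mulrA; lra.
Qed.

Lemma fentropy_comparison mu nu (I : finType) (f : X -> I) (e : R) :
  0 < e < 1 -> measurable_fibers f ->
  (forall i, (1 - e) * fine (nu (f @^-1` [set i])) <= fine (mu (f @^-1` [set i]))
    /\ fine (mu (f @^-1` [set i])) <= (1 + e) * fine (nu (f @^-1` [set i]))) ->
  fentropy nu f <= (1 - e)^-1 * fentropy mu f + e.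
Proof.
move=> e01 mf H; rewrite /fentropy mulr_sumr.
have E : \sum_i fine (nu (f @^-1` [set i])) = 1.
  have := fine_mu_fibers nu mf measurableT; rewrite probability_setT /= => ->.
  by apply: eq_bigr => i _; rewrite setTI.
rewrite -[X in _ <= _ + X]mul1r -[X in _ <= _ + X * _]E mulr_suml -big_split/=.
by apply: ler_sum => i _; apply: (eta_comparison _ _ _ (H i).1 (H i).2); rewrite ?fine_mu_itv.
Qed.

End Comparison.

(** * Uniform control of the truncations by the finite entropy of the partition *)

Section Truncation.
Context {d : measure_display} {X : measurableType d} {R : realType}.
Context (mu : probability X R) (a : X -> nat) (xi : set (set X)).
Hypotheses (ma : measurable_fibers a) (axi : codes a xi).
Hypothesis (fin_xi : (part_entropy mu xi < +oo)%E).

(** The values below [k] give a partial sum of the entropy of [xi]; the merged last value adds at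
    most [1]. *)
Lemma trunc_entropy_bounded :
  exists C : R, forall k, fentropy mu (trunc a k) <= C.
Proof.
have E := part_entropy_codes_esum mu ma axi.
have a0 i : (0%E <= (eta_fn (fine (mu (a @^-1` [set i]))))%:E :> \bar R)%E.
  by rewrite lee_fin eta_ge0// fine_mu_itv.
have ge0 : (0 <= part_entropy mu xi)%E by rewrite E; exact: esum_ge0.
have fin : part_entropy mu xi \is a fin_num by rewrite ge0_fin_numE.
exists (fine (part_entropy mu xi) + 1) => k.
rewrite /fentropy big_ord_recr/=; apply: lerD; last first.
  have /andP[p0 _] := fine_mu_itv mu (@measurable_fibers_trunc _ _ _ ma k ord_max).
  by apply: le_trans (eta_le_sub p0) _; rewrite gerBl.
rewrite -lee_fin fineK// E -sumEFin.
apply: (@le_trans _ _ (\sum_(i < k) (eta_fn (fine (mu (a @^-1` [set val i]))))%:E)%E).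
  apply: lee_sum => i _; rewrite (_ : trunc a k @^-1` _ = a @^-1` [set val i])//.
  apply/seteqP; split => x /=.
    move=> /(congr1 val); rewrite /trunc/= inordK ?ltnS ?geq_minr//.
    by have := ltn_ord i; lia.
  by move=> ax; apply/val_inj; rewrite /trunc/= inordK ?ltnS ?geq_minr// ax;
    have := ltn_ord i; lia.
apply: esum_ge; exists `I_k; first by split.
by rewrite -fsbig_ord.
Qed.

Lemma trunc_entropy_sup e : 0 < e ->
  exists m, forall k, fentropy mu (trunc a k) <= fentropy mu (trunc a m) + e.
Proof.
move=> e0; have [C hC] := trunc_entropy_bounded.
pose E := range (fun k => fentropy mu (trunc a k)).
have hE : has_sup E.
  by split; [exists (fentropy mu (trunc a 0)); exists 0%N|exists C => _ [k _ <-]].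
have [_ [m _ <-] hm] := sup_adherent e0 hE.
exists m => k; rewrite -lerBlDr; apply: le_trans (ltW hm).
by rewrite lerD2r; apply: ub_le_sup; [exact: hE.2|exists k].
Qed.

Context (T : X -> X).
Hypotheses (mT : measurable_fun setT T) (invT : T_invariant mu T).

(** Both truncations are coarser than the one at [l = maxn k m]. Its entropy conditional on
    [trunc a m] is a difference of entropies, at most [e], and [block_entropy_le] charges it once
    per time step. *)
Lemma block_rate_trunc e : 0 < e -> exists m, forall k r,
  block_rate mu T (trunc a k) r <= block_rate mu T (trunc a m) r + e.
Proof.
move=> e0; have [m hm] := trunc_entropy_sup e0; exists m => k r.
set l := maxn k m; have kl : (k <= l)%N by rewrite leq_maxl.
have ml : (m <= l)%N by rewrite leq_maxr.
have mt j : measurable_fibers (trunc a j) by exact: measurable_fibers_trunc.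
have le_kl : fentropy mu (block T (trunc a k) r.+1) <=
    fentropy mu (block T (trunc a l) r.+1).
  apply: fentropy_le; first exact: (measurable_fibers_block mT (mt l)).
  move=> x y /eq_blockP e'; apply/eq_blockP => i ilt.
  exact: trunc_determined kl _ _ (e' i ilt).
have cond_e : cond_fentropy mu (trunc a l) (trunc a m) <= e.
  rewrite /cond_fentropy (fentropy_eq mu (mt l)) ?lerBlDl//.
  - by move=> x y e'; rewrite /pairf e' (trunc_determined ml e').
  - by move=> x y [].
have H := block_entropy_le mT invT r.+1 (mt l) (mt m).
rewrite /block_rate ler_pdivrMl ?ltr0n// [leRHS]mulrDr mulVKf ?pnatr_eq0//.
apply: (le_trans le_kl); apply: (le_trans H).
by rewrite lerD2l ler_pM2l// ltr0n.
Qed.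

End Truncation.

Section BlockComparison.
Context {d : measure_display} {X : measurableType d} {R : realType}.
Context (mu nu : probability X R) (T : X -> X) (a : X -> nat).
Hypotheses (mT : measurable_fun setT T) (ma : measurable_fibers a).

(* The ratio bound on the atoms passes to their unions, hence to every
   truncation of the countable partition. *)
Lemma block_rate_comparison (r k : nat) (e : R) : 0 < e < 1 ->
  (forall x, let A := block T a r.+1 @^-1` [set block T a r.+1 x] in
    (`| mu A - nu A | <= e%:E * nu A)%E) ->
  block_rate nu T (trunc a k) r <=
  (1 - e)^-1 * block_rate mu T (trunc a k) r + e.
Proof.
move=> e01 H; have /andP[e0 e1] := e01; have e1' : 0 < 1 - e by lra.
have mb : measurable_fibers (block T a r.+1) by exact: measurable_fibers_block.
have mt : measurable_fibers (block T (trunc a k) r.+1).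
  by apply: measurable_fibers_block => //; exact: measurable_fibers_trunc.
have Hfine x : let A := block T a r.+1 @^-1` [set block T a r.+1 x] in
    `|fine (mu A) - fine (nu A)| <= e * fine (nu A).
  have := H x; rewrite /=; set A := _ @^-1` _; have mA : measurable A by exact: mb.
  rewrite -[in X in X -> _](@fineK _ (mu A)) ?fin_num_measure//.
  by rewrite -[in X in X -> _](@fineK _ (nu A)) ?fin_num_measure.
have up x : (mu (block T a r.+1 @^-1` [set block T a r.+1 x]) <=
    (1 + e)%:E * nu (block T a r.+1 @^-1` [set block T a r.+1 x]))%E.
  have := Hfine x; rewrite /=; set A := _ @^-1` _; have mA : measurable A by exact: mb.
  rewrite -[mu A]fineK ?fin_num_measure// -[nu A]fineK ?fin_num_measure//.
  by rewrite -EFinM lee_fin/= => /ler_normlP[]; lra.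
have lo x : (nu (block T a r.+1 @^-1` [set block T a r.+1 x]) <=
    ((1 - e)^-1)%:E * mu (block T a r.+1 @^-1` [set block T a r.+1 x]))%E.
  have := Hfine x; rewrite /=; set A := _ @^-1` _; have mA : measurable A by exact: mb.
  rewrite -[mu A]fineK ?fin_num_measure// -[nu A]fineK ?fin_num_measure//.
  by rewrite -EFinM lee_fin/= ler_pdivlMl// => /ler_normlP[]; lra.
(* Truncated names are functions of full names, so their fibres are unions of atoms of the join. *)
have sat u x y : block T a r.+1 x = block T a r.+1 y ->
    (block T (trunc a k) r.+1 @^-1` [set u]) x ->
    (block T (trunc a k) r.+1 @^-1` [set u]) y.
  move=> /eq_blockP xy /= <-; apply/esym/eq_blockP => i ilt.
  by rewrite /trunc xy.
have e1i : 0 <= (1 - e)^-1 by rewrite invr_ge0 ltW.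
have e1p : 0 <= 1 + e by lra.
have key : fentropy nu (block T (trunc a k) r.+1) <=
    (1 - e)^-1 * fentropy mu (block T (trunc a k) r.+1) + e.
  apply: fentropy_comparison => // u.
  set B := _ @^-1` _; have mB : measurable B by exact: mt.
  have fmu : mu B \is a fin_num by exact: fin_num_measure.
  have fnu : nu B \is a fin_num by exact: fin_num_measure.
  have := measure_saturated_le mb e1p up (sat u).
  have := measure_saturated_le mb e1i lo (sat u).
  rewrite -/B -(fineK fmu) -(fineK fnu) -!EFinM !lee_fin/=.
  by rewrite ler_pdivlMl.
(* Division by the length would leave the error [e / r.+1]; the weaker [e] is kept. *)
rewrite /block_rate ler_pdivrMl ?ltr0n// mulrDr mulrCA mulVKf ?pnatr_eq0//.
by apply: (le_trans key); rewrite lerD2l ler_peMl ?ler1n// ltW.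
Qed.

End BlockComparison.

(** * Passage to the limit *)

Lemma le_of_forall_small (R : realType) (h K : R) : 0 <= h ->
  (forall e, 0 < e < 1 -> h <= (1 - e)^-1 * (K + 2 * e) + 2 * e) -> h <= K.
Proof.
move=> h0 H; rewrite leNgt; apply/negP => Kh.
(* Clearing [1 - e] in the hypothesis yields [h - K <= e * (h + 4) - 2 * e * e], whereas this [e]
   has [e * (h + 4) <= (h - K) / 2]. *)
pose e := Num.min (1 / 3) ((h - K) / (2 * (h + 4))).
have h4 : 0 < 2 * (h + 4) by lra.
have e0 : 0 < e by rewrite lt_min !divr_gt0//; lra.
have e3 : e <= 1 / 3 by rewrite ge_min lexx.
have eh : e * (2 * (h + 4)) <= h - K by rewrite -ler_pdivlMr// ge_min lexx orbT.
have e01 : 0 < e < 1 by rewrite e0; lra.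
have := H e e01; rewrite -lerBlDr ler_pdivlMl; last by lra.
have : 0 <= e * e by rewrite mulr_ge0// ltW.
nra.
Qed.

Theorem mainTheorem1 (d : measure_display) (X : measurableType d) (R : realType)
  (T S : X -> X)
  (hTm : measurable_fun setT T) (hSm : measurable_fun setT S)
  (hTS : cancel T S) (hST : cancel S T)
  (mu : nat -> probability X R) (xi : set (set X))
  (r : nat -> nat) (eps : nat -> R) (h : R) :
  is_partition xi ->
  (part_entropy (mu 0%N) xi < +oo)%E ->
  (forall n, T_invariant (mu n) T) ->
  (forall n, 0 < eps n) ->
  (forall M : nat, exists N : nat, forall n, (N <= n)%N -> (M <= r n)%N) ->
  eps n @[n --> \oo] --> 0 ->
  (h%:E <= limn_esup (fun n => ks_entropy (mu n) T))%E ->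
  0 <= h ->
  (forall n, is_generator (mu n) T S xi) ->
  (forall n A, iter_join T xi (r n) A ->
     (`| mu 0%N A - mu n A | <= (eps n)%:E * mu n A)%E) ->
  (h%:E <= ks_entropy (mu 0%N) T)%E.
Proof.
move=> pxi fin_xi invT eps0 hr heps hsup h0 gen hat.
have [a axi ma] := countable_partition_codes pxi.
have hP c : xi c -> c = set0 \/ exists j, c = a @^-1` [set j].
  have [[x cx] xic|/set0P/negP/negPn/eqP->] := pselect (c !=set0); last by left.
  by right; exists (a x); exact/(axi _ x).
(* Real upper bounds [K] suffice: the value [+oo] is trivial, and [-oo] would allow [K = h - 1]. *)
suff key (K : R) : (ks_entropy (mu 0%N) T <= K%:E)%E -> h <= K.
  case E : (ks_entropy (mu 0%N) T) => [K| |]; last 2 first.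
  - by rewrite leey.
  - have le1 : (ks_entropy (mu 0%N) T <= (h - 1)%R%:E)%E by rewrite E leNye.
    by have := key _ le1; rewrite lerBrDr gerDl ler10.
  - by rewrite lee_fin key// E.
move=> hK; apply: le_of_forall_small => // e e01; have /andP[e0 e1] := e01.
have e1' : 0 < 1 - e by lra.
rewrite -lee_fin; apply: (le_trans hsup).
have mt k : measurable_fibers (trunc a k) by exact: measurable_fibers_trunc.
(* The levels [m] and [M] depend on [mu 0] and [e] only; the truncation [k] obtained below varies
   with [n] and the partition. *)
have [m hm] := block_rate_trunc ma axi fin_xi hTm (invT 0%N) e0.
have [M hM] := block_rate_le_ks hTm (invT 0%N) (mt m) hK e0.
have [N1 hN1] := hr M.
have /cvgrPdist_le/(_ _ e0)[N2 _ hN2] := heps.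
(* The upper limit is at most the supremum over this tail, on which [r n >= M] and [eps n <= e]. *)
apply: (@le_trans _ _ (ereal_sup
    [set ks_entropy (mu n) T | n in [set n | (maxn N1 N2 <= n)%N]])).
  by apply: ereal_inf_lbound; exists [set n | (maxn N1 N2 <= n)%N] => //;
    exists (maxn N1 N2).
apply: ge_ereal_sup => _ [n /= + <-]; rewrite geq_max => /andP[n1 n2].
apply: ge_ereal_sup => _ [P [pP fP] <-].
have [I [f fcodes mf]] := finite_partition_codes pP fP.
rewrite (part_ks_entropy_codes hTm (invT n) mf fcodes) lee_fin.
have [k hk] := generator_block_rate_le hTm hSm (invT n) hTS ma hP (gen n) e0 mf.
have [n' hn'] := hk (r n).
apply: (le_trans (limn_block_rate_le hTm (invT n) n' mf)).
(* One outer [e] pays for the generator theorem and the other for the change of measure; the two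
   inside pay for the change from [k] to [m] and for the convergence of the rate. *)
apply: (le_trans hn'); rewrite mulr2n mulrDl mul1r addrA lerD2r.
have := hN2 n n2; rewrite /= sub0r normrN gtr0_norm// => epsn.
apply: (le_trans (@block_rate_comparison _ _ _ (mu 0%N) _ _ _ hTm ma _ _ e e01 _)).
  move=> x /=; apply: le_trans (hat n _ _) _.
    by apply/(codes_iter_join T (r n) axi (x := x)).
  by rewrite lee_wpmul2r// lee_fin.
rewrite lerD2r ler_pM2l ?invr_gt0//.
have := hm k (r n); have := hM _ (hN1 n n1); lra.
Qed.
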